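(* Let $\lambda\ge 0$ be a fixed constant, and for $\gamma\ge 0$ consider the problem $$\max_{S_i,E_i}\Big\{\gamma\cdot(E_1-E_2)+\sum_{i=1}^{2}\big(S_i-\lambda\, W(S_i,E_i)\big) : (S_i,E_i)\in\mathcal{O},\ i=1,2\Big\}.$$ If $0\le\gamma^1<\gamma^2$, then the corresponding maximizers $E_1^*$ are nondecreasing, $$E^{\text{max}}\ \ge\ \underline{E}_1^*(\gamma^2)\ \ge\ \overline{E}_1^*(\gamma^1),$$ and the corresponding maximizers $E_2^*$ are nonincreasing, $$\underline{E}_2^*(\gamma^1)\ \ge\ \overline{E}_2^*(\gamma^2)\ \ge\ E^{\text{min}}.$$
   Context: Superscripts are labels, not powers; subscripts $1,2$ denote time periods. $\mathcal{O}\subset\mathbb{R}^2$ (the set of feasible operating points $(S,E)$, where $S$ is satisfaction and $E$ is energy usage) is a compact, possibly nonconvex, polygonal region, and $E^{\text{min}},E^{\text{max}}$ are the minimum and maximum of the $E$-coordinate over $\mathcal{O}$. The work function $W:\mathcal{O}\to[0,1]$ is continuous. It has exactly two global minimizers $(S^\alpha,E^\alpha),(S^\omega,E^\omega)\in\mathrm{int}(\mathcal{O})$ (at which its values are equal), with $S^\alpha<S^\omega$ and $E^\alpha<E^\omega$. For each $i\in\{1,2\}$, $E_i^*(\gamma)$ is the projection onto the $E_i$-component of the set of maximizers of the problem, $\overline{E}_i^*(\gamma)=\max E_i^*(\gamma)$ and $\underline{E}_i^*(\gamma)=\min E_i^*(\gamma)$. *)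

(* Defs.v *)
From HB Require Import structures.
From mathcomp Require Import all_boot all_order all_algebra.
From mathcomp Require Import all_classical all_reals all_analysis.

Set Implicit Arguments.
Unset Strict Implicit.
Unset Printing Implicit Defensive.

Import Order.TTheory GRing.Theory Num.Theory.
Import numFieldNormedType.Exports.

Local Open Scope classical_set_scope.
Local Open Scope ring_scope.

(* Operating points are pairs (S, E) : R * R, satisfaction first. *)

Section PolygonalRegion.
Variable R : realType.
Implicit Types (u v w : R * R) (t : (R * R) * (R * R) * (R * R)).

Definition triangle t : set (R * R) :=
  [set p | exists a b c : R,
    [/\ 0 <= a, 0 <= b, 0 <= c, a + b + c = 1 &
        p = a *: t.1.1 + b *: t.1.2 + c *: t.2]].

Definition collinear u v w : Prop :=
  (v.1 - u.1) * (w.2 - u.2) = (v.2 - u.2) * (w.1 - u.1).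

(* The triangles may overlap; neither convexity nor connectedness is
   required of the union. *)
Definition polygonal_region (O : set (R * R)) : Prop :=
  exists s : seq ((R * R) * (R * R) * (R * R)),
    (forall t, t \in s -> ~ collinear t.1.1 t.1.2 t.2) /\
    O = \bigcup_(t in [set` s]) triangle t.

End PolygonalRegion.

Section Extrema.
Variable R : realType.

(* Unlike supremums and infimums, these require attainment: each set is empty
   or a singleton. *)
Definition maximums (A : set R) : set R := A `&` ubound A.
Definition minimums (A : set R) : set R := A `&` lbound A.

Definition minimizers (T : Type) (D : set T) (f : T -> R) : set T :=
  [set x | D x /\ forall y, D y -> f x <= f y].
Definition maximizers (T : Type) (D : set T) (f : T -> R) : set T :=
  [set x | D x /\ forall y, D y -> f y <= f x].

End Extrema.

Section TwoPeriodProblem.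
Variables (R : realType) (O : set (R * R)) (W : R * R -> R) (lambda : R).

(* Period i of the text is index i - 1 : 'I_2, and x i = (S_i, E_i). *)
Definition feasible : set ('I_2 -> R * R) := [set x | forall i, O (x i)].

Definition objective (gamma : R) (x : 'I_2 -> R * R) : R :=
  gamma * ((x ord0).2 - (x ord_max).2)
  + \sum_(i < 2) ((x i).1 - lambda * W (x i)).

Definition Eopt (i : 'I_2) (gamma : R) : set R :=
  [set (x i).2 | x in maximizers feasible (objective gamma)].

End TwoPeriodProblem.

(* Main.v *)
(** The objective is a sum of one function of (S_1, E_1) and one of (S_2, E_2)
    over a product domain, so a pair is optimal iff each period separately
    maximizes c E + S - lambda W(S, E) over O, with c = gamma in period 1 and
    c = - gamma in period 2.  Adding the optimality inequalities of two slopes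
    c < c' gives (c' - c)(E' - E) >= 0, i.e. the maximizers are strongly monotone
    in c; the extreme maximizers are attained because O is compact. *)
Require Import Defs.
From HB Require Import structures.
From mathcomp Require Import all_boot all_order all_algebra.
From mathcomp Require Import all_classical all_reals all_analysis.
From mathcomp Require Import lra.
Import Order.TTheory GRing.Theory Num.Theory.
Import numFieldNormedType.Exports.
Local Open Scope classical_set_scope.
Local Open Scope ring_scope.

Section Maximizers.
Local Set Implicit Arguments.
Local Unset Strict Implicit.
Variable R : realType.

(** The extreme value theorem for the identity map on [A]. *)
Lemma compact_maximums (A : set R) :
  A !=set0 -> compact A -> exists m, maximums A m.
Proof.
move=> A0 cA.
have /(compact_EVT_max A0 cA)[m mA mub] : {within A, continuous (@id R)}.
  by apply: continuous_subspaceT => x; exact: cvg_id.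
by exists m; split; [exact: set_mem | move=> t /mem_set/mub].
Qed.

Lemma compact_minimums (A : set R) :
  A !=set0 -> compact A -> exists m, minimums A m.
Proof.
move=> A0 cA.
have /(compact_EVT_min A0 cA)[m mA mlb] : {within A, continuous (@id R)}.
  by apply: continuous_subspaceT => x; exact: cvg_id.
by exists m; split; [exact: set_mem | move=> t /mem_set/mlb].
Qed.

Lemma maximizers_neq0 (T : topologicalType) (D : set T) (f : T -> R) :
  D !=set0 -> compact D -> {within D, continuous f} -> maximizers D f !=set0.
Proof.
move=> D0 cD cf; have [c Dc cmax] := compact_EVT_max D0 cD cf.
by exists c; split; [exact: set_mem | move=> t /mem_set/cmax].
Qed.

(** Given one maximizer [c], the maximizers are the points of [D] with value at least [f c]: a
    closed condition on a compact set. *)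
Lemma compact_maximizers (T : topologicalType) (D : set T) (f : T -> R) :
  hausdorff_space T -> compact D -> {within D, continuous f} ->
  compact (maximizers D f).
Proof.
move=> hT cD cf; have [D0|D0] := pselect (D !=set0); last first.
  rewrite (_ : maximizers D f = set0); first exact: compact0.
  by apply/seteqP; split=> // x [Dx _]; apply: D0; exists x.
have [c [Dc cmax]] := maximizers_neq0 D0 cD cf.
have -> : maximizers D f = D `&` f @^-1` [set y | f c <= y].
  apply/seteqP; split=> x [Dx xmax]; split=> //; first exact: xmax.
  by move=> y /cmax /le_trans; apply.
apply: (subclosed_compact _ cD); last exact: subIsetl.
(* Continuity within [D] yields closedness only in the subspace topology; as [D] is closed in the
   Hausdorff space, this gives closedness in [T]. *)
rewrite closed_setSI; last exact: compact_closed.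
by move/continuous_closedP: cf; apply; exact: closed_ge.
Qed.

Lemma maximizers_sum (I : finType) (T : Type) (D : set T) (f : I -> T -> R) :
  maximizers [set x : I -> T | forall i, D (x i)]
    (fun x => \sum_i f i (x i)) =
  [set x | forall i, maximizers D (f i) (x i)].
Proof.
apply/seteqP; split=> [x [Dx xmax] i|x xmax] /=; last first.
  split=> [i|y Dy]; first by case: (xmax i).
  by apply: ler_sum => i _; case: (xmax i) => _; apply.
split=> // p Dp.
(* The competitor changes [x] in coordinate [i] alone, so all other terms of the two sums cancel. *)
have := xmax (fun j => if j == i then p else x j).
rewrite (bigD1 i) //= [leRHS](bigD1 i) //= eqxx.
rewrite (eq_bigr (fun j => f j (x j))) => [|j /negPf -> //].
by rewrite lerD2r; apply=> j; case: ifP.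
Qed.

Lemma maximizers_slope_le (T : Type) (D : set T) (e f : T -> R) (c d : R)
    (p q : T) :
  c < d ->
  maximizers D (fun x => c * e x + f x) p ->
  maximizers D (fun x => d * e x + f x) q ->
  e p <= e q.
Proof.
move=> cd [Dp /(_ q) pmax] [Dq /(_ p) qmax].
have {}pmax := pmax Dq; have {}qmax := qmax Dp.
have : 0 <= (d - c) * (e q - e p) by lra.
by rewrite pmulr_rge0 ?subr_gt0 // subr_ge0.
Qed.

End Maximizers.

Section Separation.
Local Set Implicit Arguments.
Local Unset Strict Implicit.
Variables (R : realType) (O : set (R * R)) (W : R * R -> R) (lambda : R).

Definition stage_payoff (c : R) (p : R * R) : R :=
  c * p.2 + (p.1 - lambda * W p).

(** The sign is absorbed here, so that both periods belong to one family of problems indexed by the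
    coefficient of E. *)
Definition slope (i : 'I_2) (gamma : R) : R :=
  if i == ord0 then gamma else - gamma.

Lemma objectiveE gamma :
  objective W lambda gamma =
  fun x => \sum_(i < 2) stage_payoff (slope i gamma) (x i).
Proof.
apply/funext => x; rewrite /objective /stage_payoff [RHS]big_split /=.
congr (_ + _); rewrite big_ord_recr big_ord1 /slope /= mulrBr mulNr.
(* Splitting off the last term leaves the first index as a widened element of ['I_1], which has the
   same value as [ord0]. *)
by congr (_ * (x _).2 - _); apply/val_inj.
Qed.

Lemma continuous_stage_payoff c :
  {within O, continuous W} -> {within O, continuous (stage_payoff c)}.
Proof.
move=> cW x; apply: cvgD.
  apply: cvgM; first exact: cvg_cst.
  by apply: (@continuous_subspaceT _ _ O snd) => ?; exact: cvg_snd.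
apply: cvgB.
  by apply: (@continuous_subspaceT _ _ O fst) => ?; exact: cvg_fst.
by apply: cvgM; [exact: cvg_cst | exact: cW].
Qed.

Hypotheses (O_neq0 : O !=set0) (O_compact : compact O).
Hypothesis W_cont : {within O, continuous W}.

Lemma EoptE i gamma :
  Eopt O W lambda i gamma =
  [set p.2 | p in maximizers O (stage_payoff (slope i gamma))].
Proof.
rewrite /Eopt objectiveE.
rewrite (maximizers_sum O (fun i => stage_payoff (slope i gamma))).
apply/seteqP; split=> e [].
  by move=> x xmax <-; exists (x i).
move=> p pmax <-.
(* A maximizer [p] of period [i] extends to an optimal pair only if the other period has a maximizer
   too; compactness provides one. *)
have m_ j : exists q, maximizers O (stage_payoff (slope j gamma)) q.
  exact: maximizers_neq0 O_neq0 O_compact (continuous_stage_payoff W_cont).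
have [x xmax] := choice m_.
exists (fun j => if j == i then p else x j); last by rewrite eqxx.
by move=> j; case: eqP => [->|_].
Qed.

Lemma Eopt_neq0 i gamma : Eopt O W lambda i gamma !=set0.
Proof.
rewrite EoptE; apply: image_nonempty.
exact: maximizers_neq0 O_neq0 O_compact (continuous_stage_payoff W_cont).
Qed.

Lemma compact_Eopt i gamma : compact (Eopt O W lambda i gamma).
Proof.
rewrite EoptE; apply: continuous_compact.
  by apply: continuous_subspaceT => ?; exact: cvg_snd.
by apply: compact_maximizers => //; exact: continuous_stage_payoff.
Qed.

Lemma Eopt_sub i gamma : Eopt O W lambda i gamma `<=` [set p.2 | p in O].
Proof. by rewrite EoptE => e [p [Op _] <-]; exists p. Qed.

(** Comparing slopes instead of [gamma] and [delta] covers both periods, although the second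
    reverses the order. *)
Lemma Eopt_le i j gamma delta e f :
  slope i gamma < slope j delta ->
  Eopt O W lambda i gamma e -> Eopt O W lambda j delta f -> e <= f.
Proof.
rewrite !EoptE => cd [p pmax <-] [q qmax <-].
exact: maximizers_slope_le cd pmax qmax.
Qed.

End Separation.

Theorem proposition5 (R : realType) (O : set (R * R)) (W : R * R -> R)
  (Emin Emax : R) (Salpha Ealpha Somega Eomega : R) (lambda : R)
  (O_compact : compact O) (O_polygonal : polygonal_region O)
  (Emin_def : minimums [set p.2 | p in O] Emin)
  (Emax_def : maximums [set p.2 | p in O] Emax)
  (W_cont : {within O, continuous W})
  (W_range : forall p, O p -> 0 <= W p <= 1)
  (W_minimizers :
     minimizers O W = [set (Salpha, Ealpha); (Somega, Eomega)])
  (alpha_int : interior O (Salpha, Ealpha))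
  (omega_int : interior O (Somega, Eomega))
  (S_lt : Salpha < Somega) (E_lt : Ealpha < Eomega)
  (lambda_ge0 : 0 <= lambda) (gamma1 gamma2 : R)
  (gamma1_ge0 : 0 <= gamma1) (gamma_lt : gamma1 < gamma2) :
  exists E1lo_gamma2 E1hi_gamma1 E2lo_gamma1 E2hi_gamma2 : R,
    [/\ minimums (Eopt O W lambda ord0 gamma2) E1lo_gamma2,
        maximums (Eopt O W lambda ord0 gamma1) E1hi_gamma1,
        minimums (Eopt O W lambda ord_max gamma1) E2lo_gamma1 &
        maximums (Eopt O W lambda ord_max gamma2) E2hi_gamma2] /\
    (Emax >= E1lo_gamma2 /\ E1lo_gamma2 >= E1hi_gamma1) /\
    (E2lo_gamma1 >= E2hi_gamma2 /\ E2hi_gamma2 >= Emin).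
Proof.
(* An interior minimizer of [W] witnesses that [O] is nonempty. *)
have O0 : O !=set0 by exists (Salpha, Ealpha); exact: interior_subset.
have hi i gamma : exists m, maximums (Eopt O W lambda i gamma) m.
  by apply: compact_maximums; [exact: Eopt_neq0 | exact: compact_Eopt].
have lo i gamma : exists m, minimums (Eopt O W lambda i gamma) m.
  by apply: compact_minimums; [exact: Eopt_neq0 | exact: compact_Eopt].
have [a amin] := lo ord0 gamma2; have [b bmax] := hi ord0 gamma1.
have [c cmin] := lo ord_max gamma1; have [d dmax] := hi ord_max gamma2.
exists a, b, c, d; split; first by split.
have sub := Eopt_sub O0 O_compact W_cont.
have le := Eopt_le O0 O_compact W_cont.
split; split.
- by apply: Emax_def.2; exact: sub amin.1.
- exact: le bmax.1 amin.1.
(* In period 2 the slopes satisfy [- gamma2 < - gamma1], so the maximizers for [gamma2] are the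
   lower ones. *)
- by apply: le dmax.1 cmin.1; rewrite /slope /= ltrN2.
- by apply: Emin_def.2; exact: sub dmax.1.
Qed.
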